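(* The dynamics on $\mathbb{R}^{|S|}\times\mathbb{R}^{|S|\times|A|}_{>0}$ $$\frac{dv_{s'}}{dt}=-\Big(v_{s'}-\frac1\alpha\sum_{s,a}K_{ass'}u_{sa}\Big),\ s'\in S,\qquad \frac{du_{sa}}{dt}=-u_{sa}\Big(\log\frac{u_{sa}}{\tilde u_s}-\frac1\tau\Big(r_{sa}-\sum_{s'}K_{ass'}v_{s'}\Big)\Big),\ (s,a)\in S\times A,$$ converges to $(v^*,u^* )$ at rate $O(e^{-ct})$ for some $c>0$, where $(v^*,u^* )$ is the unique saddle point of $\min_v\max_u E(v,u)$.
   Context: Finite MDP: state space $S$, action space $A$, transition probabilities $P_{ass'}$ (with $\sum_{s'}P_{ass'}=1$), rewards $r_{sa}\ge0$, discount $\gamma\in(0,1)$, regularization $\tau>0$, and $\alpha>0$. $K_{ass'}=\delta_{ss'}-\gamma P_{ass'}$, $\tilde u_s=\sum_a u_{sa}$, and $E(v,u)=\frac{\alpha}{2}\sum_s v_s^2+\sum_{s,a}u_{sa}(r_{sa}-\sum_{s'}K_{ass'}v_{s'})-\tau\sum_{s,a}u_{sa}\log(u_{sa}/\tilde u_s)$. This min-max problem has a unique saddle point $(v^*,u^* )$. *)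

(* Defs.v *)
From HB Require Import structures.
From mathcomp Require Import all_boot all_order all_algebra.
From mathcomp Require Import all_classical all_reals all_analysis.
Set Implicit Arguments. Unset Strict Implicit. Unset Printing Implicit Defensive.
Import Order.TTheory GRing.Theory Num.Theory.
Local Open Scope ring_scope.

Section MDP.
Variables (R : realType) (S A : finType).

(* P s a s' = P_{a s s'} : probability of moving from s to s' under action a *)
Definition Kmat (gamma : R) (P : S -> A -> S -> R) (s : S) (a : A) (s' : S) : R :=
  (s == s')%:R - gamma * P s a s'.

Definition utilde (u : S -> A -> R) (s : S) : R := \sum_(a : A) u s a.

Definition Efun (alpha tau gamma : R) (P : S -> A -> S -> R) (r : S -> A -> R)
  (v : S -> R) (u : S -> A -> R) : R :=
  alpha / 2 * \sum_(s : S) v s ^+ 2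
  + \sum_(s : S) \sum_(a : A)
      u s a * (r s a - \sum_(s' : S) Kmat gamma P s a s' * v s')
  - tau * \sum_(s : S) \sum_(a : A) u s a * ln (u s a / utilde u s).

Definition posu (u : S -> A -> R) : Prop := forall s a, 0 < u s a.

Definition is_saddle (alpha tau gamma : R) (P : S -> A -> S -> R) (r : S -> A -> R)
  (vs : S -> R) (us : S -> A -> R) : Prop :=
  posu us /\
  (forall v, Efun alpha tau gamma P r vs us <= Efun alpha tau gamma P r v us) /\
  (forall u, posu u -> Efun alpha tau gamma P r vs u <= Efun alpha tau gamma P r vs us).

Definition vfield (alpha gamma : R) (P : S -> A -> S -> R)
  (v : S -> R) (u : S -> A -> R) (s' : S) : R :=
  - (v s' - alpha^-1 * \sum_(s : S) \sum_(a : A) Kmat gamma P s a s' * u s a).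

Definition ufield (tau gamma : R) (P : S -> A -> S -> R) (r : S -> A -> R)
  (v : S -> R) (u : S -> A -> R) (s : S) (a : A) : R :=
  - (u s a * (ln (u s a / utilde u s)
       - tau^-1 * (r s a - \sum_(s' : S) Kmat gamma P s a s' * v s'))).

End MDP.

(* Main.v *)
(**
Write [w = v - vs], [d = u - us] and [y = ln pi - ln pi_s], where [pi] and
[pi_s] are the policies of [u] and [us]. The first-order conditions at the
saddle point turn the flow into
[w' = - (w - K^T d / alpha)] and [u' = - u (y + K w / tau)], so that the energy
[L = alpha / 2 |w|^2 + tau sum (us ln (us / u) - us + u)]
satisfies [L' = - (alpha |w|^2 + tau sum d y)]. On a sublevel set of [L] the
entries of [u] stay in a compact part of the positive reals, and there
[sum d y >= const |y|^2]; but this dissipation does not see the marginals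
[sum_a d]. The cross term [- <w, K^T d>] repairs this: its derivative contains
[- |K^T d|^2 / alpha], and since the discount factor is less than 1, [K^T d]
and [y] together control [d] in l1 norm. Hence [L - eps <w, K^T d>] decays
exponentially, at a rate that depends only on the sublevel set; every
trajectory enters the sublevel set [L <= 1], which makes the rate uniform.
*)

Require Import Defs.
From HB Require Import structures.
From mathcomp Require Import all_boot all_order all_algebra.
From mathcomp Require Import all_classical all_reals all_analysis.
From mathcomp Require Import ring lra.
Set Implicit Arguments.
Unset Strict Implicit.
Unset Printing Implicit Defensive.
Import Order.TTheory GRing.Theory Num.Theory.
Local Open Scope ring_scope.

Section RelativeEntropy.
Context {R : realType}.
Implicit Types x p q c : R.

Lemma ln_le_subr1 x : 0 < x -> ln x <= x - 1.
Proof.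
move=> x_gt0; have := @le_ln1Dx R (x - 1).
by rewrite [1 + _]addrC subrK; apply; lra.
Qed.

Lemma expR_ge1D_sqr x : - 2 <= x -> 1 + x + x ^+ 2 / 4 <= expR x.
Proof.
move=> x_geN2; have -> : 1 + x + x ^+ 2 / 4 = (1 + x / 2) ^+ 2 by field.
have -> : expR x = expR (x / 2) ^+ 2 by rewrite expr2 -expRD; congr expR; lra.
rewrite ler_sqr ?nnegrE ?expR_ge0 ?expR_ge1Dx//; lra.
Qed.

Lemma dist_le_mul_dist_ln p q c : 0 < p -> 0 < q -> p <= c -> q <= c ->
  `|p - q| <= c * `|ln p - ln q|.
Proof.
wlog qp : p q / q <= p => [wlog_le p_gt0 q_gt0 pc qc|p_gt0 q_gt0 pc _].
  have [/wlog_le|/ltW pq] := leP q p; first by apply.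
  by rewrite distrC [X in _ <= c * X]distrC; apply: wlog_le.
have lnqp : ln q <= ln p by rewrite ler_ln ?posrE.
rewrite !ger0_norm ?subr_ge0//.
apply: (@le_trans _ _ (p * (ln p - ln q))); last by rewrite ler_wpM2r ?subr_ge0.
have : p * (ln q - ln p) <= p * (q / p - 1).
  by rewrite ler_pM2l// -ln_div ?posrE// ln_le_subr1 ?divr_gt0.
by rewrite [in X in _ <= X]mulrBr [p * (q / p)]mulrC divfK ?gt_eqF//; lra.
Qed.

Definition kldiv p q : R := p * ln (p / q) - p + q.

(* [ln (p / q) = - 2 ln (sqrt q / sqrt p)], and [ln x <= x - 1]. *)
Lemma hellinger_le_kldiv p q : 0 < p -> 0 < q ->
  (Num.sqrt p - Num.sqrt q) ^+ 2 <= kldiv p q.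
Proof.
move=> p_gt0 q_gt0; rewrite /kldiv.
have := sqr_sqrtr (ltW p_gt0); have := sqr_sqrtr (ltW q_gt0).
have : 0 < Num.sqrt p by rewrite sqrtr_gt0.
have : 0 < Num.sqrt q by rewrite sqrtr_gt0.
move: (Num.sqrt p) (Num.sqrt q) => a b b_gt0 a_gt0 <- <-.
have -> : ln (a ^+ 2 / b ^+ 2) = - (2 * ln (b / a)).
  rewrite -expr_div_n lnXn ?divr_gt0// !ln_div ?posrE// -mulr_natl; ring.
have : a ^+ 2 * ln (b / a) <= a ^+ 2 * (b / a - 1).
  by rewrite ler_pM2l ?exprn_gt0// ln_le_subr1 ?divr_gt0.
have -> : a ^+ 2 * (b / a - 1) = a * b - a ^+ 2 by field; rewrite gt_eqF.
lra.
Qed.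

Lemma kldiv_ge0 p q : 0 < p -> 0 < q -> 0 <= kldiv p q.
Proof.
move=> p_gt0 q_gt0.
exact: le_trans (sqr_ge0 _) (hellinger_le_kldiv p_gt0 q_gt0).
Qed.

Lemma le_kldivD p q : 0 < p -> 0 < q -> q <= 2 * (kldiv p q + p).
Proof.
move=> p_gt0 q_gt0; have := hellinger_le_kldiv p_gt0 q_gt0.
have := sqr_sqrtr (ltW p_gt0); have := sqr_sqrtr (ltW q_gt0).
have := sqr_ge0 (2 * Num.sqrt p - Num.sqrt q).
lra.
Qed.

Lemma sqr_dist_le_kldiv p q : 0 < p -> 0 < q ->
  (q - p) ^+ 2 <= 2 * (p + q) * kldiv p q.
Proof.
move=> p_gt0 q_gt0.
apply: (@le_trans _ _ (2 * (p + q) * (Num.sqrt p - Num.sqrt q) ^+ 2)).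
  have := sqr_sqrtr (ltW p_gt0); have := sqr_sqrtr (ltW q_gt0).
  move: (Num.sqrt p) (Num.sqrt q) => a b <- <-.
  have -> : (b ^+ 2 - a ^+ 2) ^+ 2 = (a + b) ^+ 2 * (a - b) ^+ 2 by ring.
  by apply: ler_wpM2r; [exact: sqr_ge0 | have := sqr_ge0 (a - b); lra].
by apply: ler_wpM2l; [lra | exact: hellinger_le_kldiv].
Qed.

Lemma kldiv_le_chi2 p q : 0 < p -> 0 < q -> kldiv p q <= (q - p) ^+ 2 / q.
Proof.
move=> p_gt0 q_gt0; have -> : (q - p) ^+ 2 / q = p * (p / q - 1) - p + q.
  by field; rewrite gt_eqF.
by rewrite /kldiv !lerD2r ler_pM2l// ln_le_subr1// divr_gt0.
Qed.

Lemma kldiv_ge_sqr_ln p q : 0 < p -> p <= q ->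
  p / 4 * ln (p / q) ^+ 2 <= kldiv p q.
Proof.
move=> p_gt0 pq; have q_gt0 : 0 < q by exact: lt_le_trans pq.
have -> : ln (p / q) = - ln (q / p) by rewrite -lnV ?posrE ?divr_gt0// invf_div.
have lnqp_ge0 : 0 <= ln (q / p) by rewrite ln_ge0// ler_pdivlMr ?mul1r.
have -> : kldiv p q = p * (expR (ln (q / p)) - 1 - ln (q / p)).
  rewrite lnK ?posrE ?divr_gt0// /kldiv -invf_div lnV ?posrE ?divr_gt0//.
  by field; rewrite gt_eqF.
have lnqp_geN2 : - 2 <= ln (q / p) by exact: le_trans lnqp_ge0.
by rewrite sqrrN -mulrA ler_pM2l//; have := expR_ge1D_sqr lnqp_geN2; lra.
Qed.

Lemma kldivD_ge_sqr_ln p q p' q' m : 0 < p -> 0 < q -> 0 < p' -> 0 < q' ->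
  ln (p' / q') = - ln (p / q) -> m <= p -> m <= p' ->
  m / 4 * ln (p / q) ^+ 2 <= kldiv p q + kldiv p' q'.
Proof.
wlog lnpq_le0 : p q p' q' / ln (p / q) <= 0 => [wlog_le0|].
  have [/wlog_le0|/ltW lnpq_ge0] := leP (ln (p / q)) 0; first exact.
  move=> p_gt0 q_gt0 p'_gt0 q'_gt0 lnE mp mp'; rewrite addrC -sqrrN -lnE.
  by apply: wlog_le0 => //; rewrite ?lnE ?opprK// oppr_le0.
move=> p_gt0 q_gt0 p'_gt0 q'_gt0 _ mp _.
have pq : p <= q.
  by rewrite -[q]mul1r -ler_pdivrMr// -ler_ln ?posrE ?divr_gt0// ln1.
apply: (@le_trans _ _ (kldiv p q)); last by rewrite lerDl kldiv_ge0.
apply: le_trans (kldiv_ge_sqr_ln p_gt0 pq).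
by rewrite ler_wpM2r ?sqr_ge0// ler_pM2r.
Qed.

Lemma kldiv_le_lbound p q c : 0 < p -> 0 < q -> kldiv p q <= c ->
  p * expR (- (c / p + 1)) <= q.
Proof.
move=> p_gt0 q_gt0 klc.
rewrite expRN ler_pdivrMr ?expR_gt0// mulrC -ler_pdivrMr//.
rewrite -ler_ln ?posrE ?divr_gt0 ?expR_gt0// expRK -lerBlDr ler_pdivlMr//.
by move: klc; rewrite /kldiv; lra.
Qed.

End RelativeEntropy.

Section FiniteSums.
Context {R : numDomainType}.
Implicit Types I J : finType.

Lemma ler_sum2 I J (f g : I -> J -> R) : (forall i j, f i j <= g i j) ->
  \sum_i \sum_j f i j <= \sum_i \sum_j g i j.
Proof. by move=> fg; apply: ler_sum => i _; apply: ler_sum => j _. Qed.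

Lemma sumr2_ge0 I J (f : I -> J -> R) : (forall i j, 0 <= f i j) ->
  0 <= \sum_i \sum_j f i j.
Proof. by move=> f_ge0; apply: sumr_ge0 => i _; apply: sumr_ge0 => j _. Qed.

Lemma mulr_sumr2 I J (c : R) (f : I -> J -> R) :
  c * (\sum_i \sum_j f i j) = \sum_i \sum_j c * f i j.
Proof. by rewrite mulr_sumr; apply: eq_bigr => i _; rewrite mulr_sumr. Qed.

Lemma sumr2_const I J (x : R) :
  \sum_(i : I) \sum_(j : J) x = (#|I| * #|J|)%:R * x.
Proof. by rewrite pair_bigA sumr_const -cardX mulr_natl. Qed.

Lemma ler_sum_term I (f : I -> R) i : (forall j, 0 <= f j) -> f i <= \sum_j f j.
Proof. by move=> f_ge0; rewrite (bigD1 i)//= lerDl sumr_ge0. Qed.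

Lemma ler_sum2_term I J (f : I -> J -> R) i j : (forall k l, 0 <= f k l) ->
  f i j <= \sum_k \sum_l f k l.
Proof.
move=> f_ge0; rewrite pair_bigA.
by apply: (@ler_sum_term _ (fun p => f p.1 p.2) (i, j)) => p.
Qed.

End FiniteSums.

Section FiniteBounds.
Context {R : realDomainType} {I : finType}.
Implicit Types f : I -> R.

Lemma fin_lbound_gt0 f : (forall i, 0 < f i) ->
  exists2 m, 0 < m & forall i, m <= f i.
Proof.
move=> f_gt0; exists (\big[Num.min/1]_i f i) => [|i]; last exact: bigmin_le.
by apply: lt_bigmin.
Qed.

Lemma fin_ubound_gt0 f : exists2 M, 0 < M & forall i, f i <= M.
Proof.
exists (\big[Num.max/1]_i f i) => [|i]; last exact: le_bigmax.
exact: lt_le_trans ltr01 (bigmax_ge_id _ _ _ _).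
Qed.

End FiniteBounds.

Section SumsOfSquares.
Context {R : realFieldType}.
Implicit Types I J : finType.

Definition sumsq I (x : I -> R) : R := \sum_i x i ^+ 2.

Definition sumsq2 I J (x : I -> J -> R) : R := \sum_i \sum_j x i j ^+ 2.

Lemma sumsq_ge0 I (x : I -> R) : 0 <= sumsq x.
Proof. by apply: sumr_ge0 => i _; exact: sqr_ge0. Qed.

Lemma sumsq2_ge0 I J (x : I -> J -> R) : 0 <= sumsq2 x.
Proof. by apply: sumr2_ge0 => i j; exact: sqr_ge0. Qed.

Lemma sqr_sum_le I (x : I -> R) : (\sum_i x i) ^+ 2 <= #|I|%:R * sumsq x.
Proof.
have -> : #|I|%:R * sumsq x =
    \sum_(i : I) \sum_(j : I) (x i ^+ 2 / 2 + x j ^+ 2 / 2).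
  under [RHS]eq_bigr do rewrite big_split/= sumr_const -mulr_suml.
  rewrite big_split/= sumr_const sumrMnl -mulr_suml -mulrnDl -splitr.
  by rewrite mulr_natl.
rewrite expr2 mulr_suml; apply: ler_sum => i _.
rewrite mulr_sumr; apply: ler_sum => j _.
by have := sqr_ge0 (x i - x j); lra.
Qed.

Lemma sqr_sum2_le I J (x : I -> J -> R) :
  (\sum_i \sum_j x i j) ^+ 2 <= (#|I| * #|J|)%:R * sumsq2 x.
Proof.
rewrite /sumsq2 !pair_bigA -cardX.
exact: (sqr_sum_le (fun p : I * J => x p.1 p.2)).
Qed.

Lemma sqr_sum_norm_le I (x : I -> R) :
  (\sum_i `|x i|) ^+ 2 <= #|I|%:R * sumsq x.
Proof.
have -> : sumsq x = sumsq (fun i => `|x i|).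
  by apply: eq_bigr => i _; rewrite real_normK ?num_real.
exact: sqr_sum_le.
Qed.

Lemma sqr_sum2_norm_le I J (x : I -> J -> R) :
  (\sum_i \sum_j `|x i j|) ^+ 2 <= (#|I| * #|J|)%:R * sumsq2 x.
Proof.
rewrite /sumsq2 !pair_bigA -cardX.
exact: (sqr_sum_norm_le (fun p : I * J => x p.1 p.2)).
Qed.

Lemma sumsq2_le_sqr_sum_norm I J (x : I -> J -> R) :
  sumsq2 x <= (\sum_i \sum_j `|x i j|) ^+ 2.
Proof.
rewrite expr2 mulr_sumr2; apply: ler_sum2 => i j.
rewrite -(real_normK (num_real (x i j))) expr2; apply: ler_wpM2r => //.
exact: (ler_sum2_term (f := fun i j => `|x i j|)).
Qed.

Lemma norm_sum_mul_le I (x y : I -> R) (c : R) : 0 < c ->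
  `|\sum_i x i * y i| <= c / 2 * sumsq x + sumsq y / (2 * c).
Proof.
move=> c_gt0; apply: le_trans (ler_norm_sum _ _ _) _.
rewrite mulr_sumr mulr_suml -big_split; apply: ler_sum => i _ /=.
rewrite normrM -(real_normK (num_real (x i))) -(real_normK (num_real (y i))).
rewrite -subr_ge0 (_ : _ - _ = (c * `|x i| - `|y i|) ^+ 2 / (2 * c)).
  by rewrite divr_ge0 ?sqr_ge0// mulr_ge0// ltW.
by field; rewrite gt_eqF.
Qed.

End SumsOfSquares.

Section Calculus.
Context {R : realType}.
Implicit Types (f g : R -> R) (t c : R).

Lemma is_derive_fsum (I : finType) (h : I -> R -> R) t (dh : I -> R) :
  (forall i, is_derive t 1 (h i) (dh i)) ->
  is_derive t 1 (fun x => \sum_i h i x) (\sum_i dh i).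
Proof.
move=> dhP; rewrite (_ : (fun x => _) = \sum_i h i); last first.
  by apply/funext => x; rewrite fct_sumE.
by elim/big_ind2 : _ => // [|] *; [exact: is_derive_cst | exact: is_deriveD].
Qed.

Lemma is_derive_mulf f g t df dg :
  is_derive t 1 f df -> is_derive t 1 g dg ->
  is_derive t 1 (fun x => f x * g x) (f t * dg + g t * df).
Proof. by move=> *; exact: is_deriveM. Qed.

Lemma is_derive_scalef c f t df :
  is_derive t 1 f df -> is_derive t 1 (fun x => c * f x) (c * df).
Proof. by move=> *; exact: is_deriveZ. Qed.

Lemma is_derive_subc f t df c :
  is_derive t 1 f df -> is_derive t 1 (fun x => f x - c) df.
Proof.
move=> fP; apply: is_derive_eq (is_deriveB fP (is_derive_cst c t 1)) _.
exact: subr0.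
Qed.

Lemma is_derive_expRM c t :
  is_derive t 1 (fun x => expR (c * x)) (c * expR (c * t)).
Proof.
have cP := is_derive_scalef c (is_derive_id t (1 : R)).
apply: is_derive_eq (is_derive1_comp (is_derive_expR (c * t)) cP) _.
by rewrite mulr1 mulrC.
Qed.

Lemma is_derive_ln_div f g t df dg : 0 < f t -> 0 < g t ->
  is_derive t 1 f df -> is_derive t 1 g dg ->
  is_derive t 1 (fun x => ln (f x / g x)) (df / f t - dg / g t).
Proof.
move=> ft_gt0 gt_gt0 fP gP.
have fgP := is_derive_mulf fP (is_deriveV (lt0r_neq0 gt_gt0) gP).
have ln_fgP := is_derive1_ln (divr_gt0 ft_gt0 gt_gt0).
have ln_fg := @is_derive1_comp _ (@ln R) (fun x => f x / g x) t _ _ ln_fgP fgP.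
apply: is_derive_eq ln_fg _.
by rewrite /GRing.scale/=; field; rewrite !gt_eqF.
Qed.

Lemma is_derive_kldiv c f t df : 0 < c -> 0 < f t -> is_derive t 1 f df ->
  is_derive t 1 (fun x => kldiv c (f x)) (df - c * (df / f t)).
Proof.
move=> c_gt0 ft_gt0 fP.
have lnP := is_derive_ln_div c_gt0 ft_gt0 (is_derive_cst c t 1) fP.
have entropyP := is_derive_subc c (is_derive_scalef c lnP).
apply: is_derive_eq (is_deriveD entropyP fP) _.
by rewrite mul0r sub0r mulrN addrC.
Qed.

Lemma is_derive_le0_nincr f (df : R -> R) a b : a <= b ->
  (forall t, a <= t -> is_derive t 1 f (df t)) ->
  (forall t, a <= t -> df t <= 0) -> f b <= f a.
Proof.
move=> ab fP df_le0.
have fder t : a <= t -> derivable f t 1 by move=> /fP [].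
apply: (@ler0_derive1_le_cc _ f a b); rewrite ?in_itv/= ?lexx ?ab//.
- by move=> t; rewrite in_itv/= => /andP[/ltW /fder].
- move=> t; rewrite in_itv/= => /andP[/ltW at_ _].
  by have [_ dfE] := fP t at_; rewrite derive1E dfE df_le0.
- apply: derivable_within_continuous => t.
  by rewrite in_itv/= => /andP[/fder].
Qed.

Lemma gronwall f (df : R -> R) c a b : a <= b ->
  (forall t, a <= t -> is_derive t 1 f (df t)) ->
  (forall t, a <= t -> df t <= - (c * f t)) ->
  f b <= f a * expR (- (c * (b - a))).
Proof.
move=> ab fP df_le.
pose dg t := f t * (c * expR (c * t)) + expR (c * t) * df t.
have -> : expR (- (c * (b - a))) = expR (c * a) / expR (c * b).
  by rewrite -expRN -expRD; congr expR; ring.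
rewrite mulrA ler_pdivlMr ?expR_gt0//.
apply: (@is_derive_le0_nincr (fun t => f t * expR (c * t)) dg) => // t at_.
  exact: is_derive_mulf (fP t at_) (is_derive_expRM c t).
by have := ler_wpM2l (expR_ge0 (c * t)) (df_le t at_); rewrite /dg; lra.
Qed.

(* [L + eps X] is equivalent to [L], and its decay passes to [L]. *)
Lemma modified_energy_decay (L X dL dX : R -> R) eps c a b : 0 <= c -> a <= b ->
  (forall t, a <= t -> is_derive t 1 L (dL t)) ->
  (forall t, a <= t -> is_derive t 1 X (dX t)) ->
  (forall t, a <= t -> `|eps * X t| <= L t / 2) ->
  (forall t, a <= t -> c * L t <= - (dL t + eps * dX t)) ->
  L b <= 3 * L a * expR (- (c / 2 * (b - a))).
Proof.
move=> c_ge0 ab LP XP epsX_le cL_le.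
have /ler_normlP[epsXb _] := epsX_le b ab.
have /ler_normlP[_ epsXa] := epsX_le a (lexx a).
have : L b + eps * X b <=
    (L a + eps * X a) * expR (- (c / 2 * (b - a))).
  apply: (gronwall (f := fun t => L t + eps * X t)
    (df := fun t => dL t + eps * dX t)) => // t at_.
    exact: is_deriveD (LP t at_) (is_derive_scalef eps (XP t at_)).
  have /ler_normlP[_ epsXt] := epsX_le t at_.
  have L_ge0 : 0 <= L t.
    by have := normr_ge0 (eps * X t); have := epsX_le t at_; lra.
  have := cL_le t at_; have := ler_wpM2l c_ge0 epsXt.
  by have := mulr_ge0 c_ge0 L_ge0; lra.
have := expR_gt0 (- (c / 2 * (b - a))); move: (expR _) => e e_gt0 decay.
have : (L a + eps * X a) * e <= 3 / 2 * L a * e by rewrite ler_pM2r//; lra.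
lra.
Qed.

Lemma eventually_expR_decay f M K c a : 0 <= c -> 0 <= M -> 0 <= K ->
  (forall t, 0 < t -> f t <= M) ->
  (forall t, a <= t -> f t <= K * expR (- (c * (t - a)))) ->
  forall t, 0 < t -> f t <= (M + K) * expR (c * a) * expR (- (c * t)).
Proof.
move=> c_ge0 M_ge0 K_ge0 f_le f_decay t t_gt0; rewrite -mulrA -expRD.
have -> : c * a - c * t = - (c * (t - a)) by ring.
have [/f_decay at_|/ltW ta] := leP a t.
  by apply: le_trans at_ _; rewrite ler_wpM2r ?expR_ge0// lerDr.
apply: le_trans (f_le t t_gt0) _.
apply: (@le_trans _ _ (M + K)); first by rewrite lerDl.
rewrite ler_peMr ?addr_ge0// -[leLHS]expR0 ler_expR oppr_ge0.
by rewrite mulr_ge0_le0// subr_le0.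
Qed.

Lemma le_sqrt_expR_half x K c t : 0 <= K -> x ^+ 2 <= K * expR (- (c * t)) ->
  x <= Num.sqrt K * expR (- (c / 2 * t)).
Proof.
move=> K_ge0 xK; apply: le_trans (ler_norm x) _.
rewrite -sqrtr_sqr -[expR _]gtr0_norm ?expR_gt0// -sqrtr_sqr -sqrtrM//.
rewrite ler_wsqrtr// (le_trans xK)// expr2 -expRD.
by have -> : - (c / 2 * t) + - (c / 2 * t) = - (c * t) by field.
Qed.

(* If the dissipation [D] only controls [W], but the cross term [X] has a rate
   of change [dX] whose leading part is [- k' * Q], then [L + eps X] decays. *)
Lemma hypocoercivity_constants (k k' B C E : R) :
  0 < k -> 0 < k' -> 0 < B -> 0 < C -> 0 < E ->
  exists eps c, [/\ 0 < eps, 0 < c & forall W Q L D X dX : R,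
    0 <= W -> 0 <= Q -> k * W <= D -> `|X| <= B * L ->
    dX <= C * W - k' * Q -> L <= E * (W + Q) ->
    `|eps * X| <= L / 2 /\ c * L <= D - eps * dX].
Proof.
move=> k_gt0 k'_gt0 B_gt0 C_gt0 E_gt0.
pose eps := Num.min (2 * B)^-1 (k / (2 * C)).
have eps_gt0 : 0 < eps by rewrite lt_min invr_gt0 divr_gt0 ?mulr_gt0.
have epsB : eps * (2 * B) <= 1.
  by rewrite -ler_pdivlMr ?mulr_gt0// div1r ge_min lexx.
have epsC : eps * (2 * C) <= k.
  by rewrite -ler_pdivlMr ?mulr_gt0// ge_min lexx orbT.
pose c := Num.min (k / 2) (eps * k').
have c_gt0 : 0 < c by rewrite lt_min divr_gt0 ?mulr_gt0.
have c_le_k : c <= k / 2 by rewrite ge_min lexx.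
have c_le_k' : c <= eps * k' by rewrite ge_min lexx orbT.
exists eps, (c / E); split; rewrite ?divr_gt0//.
move=> W Q L D X dX W_ge0 Q_ge0 D_ge X_le dX_le L_le; split.
  have L_ge0 : 0 <= L by rewrite -(pmulr_rge0 _ B_gt0) (le_trans _ X_le).
  rewrite normrM gtr0_norm//; have := ler_wpM2r L_ge0 epsB.
  by have := ler_wpM2l (ltW eps_gt0) X_le; lra.
apply: (@le_trans _ _ (c * (W + Q))).
  by rewrite -mulrA ler_pM2l// mulrC ler_pdivrMr// mulrC.
have := ler_wpM2r W_ge0 c_le_k; have := ler_wpM2r Q_ge0 c_le_k'.
have := ler_wpM2r W_ge0 epsC; have := ler_wpM2l (ltW eps_gt0) dX_le.
lra.
Qed.

End Calculus.

Section RegularizedMDP.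
Context {R : realType} {S A : finType}.
Variables (P : S -> A -> S -> R) (r : S -> A -> R) (gamma tau alpha : R).
Variables (vs : S -> R) (us : S -> A -> R).
Implicit Types (v w : S -> R) (u d : S -> A -> R) (m U M : R).

Definition policy u s a : R := u s a / utilde u s.

Lemma utilde_gt0 u s (a : A) : posu u -> 0 < utilde u s.
Proof.
move=> u_gt0; rewrite /utilde (bigD1 a)//= ltr_wpDr//.
by apply: sumr_ge0 => b _; exact: ltW.
Qed.

Lemma le_utilde u s a : posu u -> u s a <= utilde u s.
Proof. by move=> u_gt0; apply: ler_sum_term => b; exact: ltW. Qed.

Lemma policy_gt0 u s a : posu u -> 0 < policy u s a.
Proof. by move=> u_gt0; rewrite divr_gt0// (utilde_gt0 _ a). Qed.

Lemma policy_le1 u s a : posu u -> policy u s a <= 1.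
Proof.
by move=> u_gt0; rewrite ler_pdivrMr ?mul1r ?le_utilde// (utilde_gt0 _ a).
Qed.

Lemma sum_policy u s (a : A) : posu u -> \sum_b policy u s b = 1.
Proof.
by move=> u_gt0; rewrite -mulr_suml divff// gt_eqF// (utilde_gt0 _ a).
Qed.

(* Equality fails when [A] is empty. *)
Lemma sum_policy_le1 u s : posu u -> \sum_a policy u s a <= 1.
Proof.
move=> u_gt0; have [a _|A0] := pickP (fun _ : A => true).
  by rewrite (sum_policy _ a).
by rewrite big_pred0 => // a; have := A0 a.
Qed.

Lemma sum_utilde_policy u u' s : posu u' ->
  \sum_a utilde u s * policy u' s a = utilde u s.
Proof.
move=> u'_gt0; have [a _|A0] := pickP (fun _ : A => true).
  by rewrite -mulr_sumr (sum_policy _ a)// mulr1.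
by rewrite /utilde !big_pred0 => // a; have := A0 a.
Qed.

Lemma ln_div_utilde_policy u u' s a : posu u -> posu u' ->
  ln (u s a / (utilde u s * policy u' s a)) =
  ln (policy u s a) - ln (policy u' s a).
Proof.
move=> u_gt0 u'_gt0.
by rewrite invfM mulrA ln_div ?posrE ?policy_gt0// divr_gt0// (utilde_gt0 _ a).
Qed.

Definition Kapp w s a : R := \sum_s' Kmat gamma P s a s' * w s'.

Definition Kadj d s' : R := \sum_s \sum_a Kmat gamma P s a s' * d s a.

Lemma sum_mul_Kapp d w :
  \sum_s \sum_a d s a * Kapp w s a = \sum_s w s * Kadj d s.
Proof.
under eq_bigr do under eq_bigr do rewrite mulr_sumr.
under eq_bigr do rewrite exchange_big.
rewrite exchange_big; apply: eq_bigr => s' _; rewrite mulr_sumr2.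
by apply: eq_bigr => s _; apply: eq_bigr => a _; ring.
Qed.

Lemma KappB w w' s a :
  Kapp (fun s => w s - w' s) s a = Kapp w s a - Kapp w' s a.
Proof. by rewrite /Kapp -sumrB; apply: eq_bigr => t _; rewrite mulrBr. Qed.

Lemma KadjB d d' s :
  Kadj (fun s a => d s a - d' s a) s = Kadj d s - Kadj d' s.
Proof.
rewrite /Kadj -sumrB; apply: eq_bigr => t _.
by rewrite -sumrB; apply: eq_bigr => a _; rewrite mulrBr.
Qed.

Lemma KadjE d s' :
  Kadj d s' = utilde d s' - gamma * \sum_s \sum_a P s a s' * d s a.
Proof.
rewrite mulr_sumr2 /Kadj /Kmat.
have -> : utilde d s' = \sum_s \sum_a (s == s')%:R * d s a.
  rewrite [RHS](bigD1 s')//= [X in _ + X]big1 ?addr0 => [|s /negPf ss'].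
    by apply: eq_bigr => a _; rewrite eqxx mul1r.
  by apply: big1 => a _; rewrite ss' mul0r.
rewrite -sumrB; apply: eq_bigr => s _.
by rewrite -sumrB; apply: eq_bigr => a _; ring.
Qed.

Definition vdev v s : R := v s - vs s.

Definition udev u s a : R := u s a - us s a.

Definition logdev u s a : R := ln (policy u s a) - ln (policy us s a).

Definition relent u : R := \sum_s \sum_a kldiv (us s a) (u s a).

Definition lyap v u : R := alpha / 2 * sumsq (vdev v) + tau * relent u.

Definition dissip v u : R := alpha * sumsq (vdev v) +
  tau * \sum_s \sum_a udev u s a * logdev u s a.

Definition cross v u : R := - \sum_s vdev v s * Kadj (udev u) s.

Definition cross_rate v u : R :=
  \sum_s vdev v s * Kadj (udev u) s - sumsq (Kadj (udev u)) / alpha +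
  \sum_s \sum_a Kapp (vdev v) s a *
    (u s a * (logdev u s a + Kapp (vdev v) s a / tau)).

Hypotheses (P_ge0 : forall s a s', 0 <= P s a s')
  (P_sum1 : forall s a, \sum_s' P s a s' = 1)
  (gamma_gt0 : 0 < gamma) (gamma_lt1 : gamma < 1)
  (tau_gt0 : 0 < tau) (alpha_gt0 : 0 < alpha) (us_gt0 : posu us).

Lemma Kmat_sqr_le1 s a s' : Kmat gamma P s a s' ^+ 2 <= 1.
Proof.
have P_le1 : P s a s' <= 1.
  by rewrite -(P_sum1 s a); exact: (ler_sum_term (f := P s a)).
have : gamma * P s a s' <= 1 by rewrite mulr_ile1// ltW.
have : 0 <= gamma * P s a s' by rewrite mulr_ge0// ltW.
rewrite /Kmat; move: (gamma * _) => g g_ge0 g_le1.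
by case: (s == s') => /=; nra.
Qed.

Lemma Kapp_sqr_le w s a : Kapp w s a ^+ 2 <= #|S|%:R * sumsq w.
Proof.
apply: le_trans (sqr_sum_le _) _; apply: ler_wpM2l => //.
by apply: ler_sum => s' _; rewrite exprMn ler_piMl ?sqr_ge0 ?Kmat_sqr_le1.
Qed.

Lemma sumsq_Kadj_le d :
  sumsq (Kadj d) <= (#|S| * (#|S| * #|A|))%:R * sumsq2 d.
Proof.
have Kadj_sqr_le s' : Kadj d s' ^+ 2 <= (#|S| * #|A|)%:R * sumsq2 d.
  apply: le_trans (sqr_sum2_le _) _; apply: ler_wpM2l => //.
  by apply: ler_sum2 => s a; rewrite exprMn ler_piMl ?sqr_ge0 ?Kmat_sqr_le1.
rewrite natrM -mulrA; apply: le_trans (ler_sum _ (fun s _ => Kadj_sqr_le s)) _.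
by rewrite sumr_const [leRHS]mulr_natl.
Qed.

Lemma sum_norm_utilde_le d :
  \sum_s `|utilde d s| <=
  \sum_s `|Kadj d s| + gamma * \sum_s \sum_a `|d s a|.
Proof.
have -> : \sum_s \sum_a `|d s a| = \sum_s' \sum_s \sum_a P s a s' * `|d s a|.
  rewrite [RHS]exchange_big; apply: eq_bigr => s _.
  rewrite [RHS]exchange_big; apply: eq_bigr => a _.
  by rewrite -mulr_suml P_sum1 mul1r.
rewrite mulr_sumr -big_split; apply: ler_sum => s' _ /=.
have -> : utilde d s' = Kadj d s' + gamma * \sum_s \sum_a P s a s' * d s a.
  by rewrite KadjE subrK.
apply: le_trans (ler_normD _ _) _; rewrite lerD2l normrM (gtr0_norm gamma_gt0).
rewrite ler_pM2l//; apply: le_trans (ler_norm_sum _ _ _) _.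
apply: ler_sum => s _; apply: le_trans (ler_norm_sum _ _ _) _.
by apply: ler_sum => a _; rewrite normrM (ger0_norm (P_ge0 _ _ _)).
Qed.

Lemma sum_udev_logdevE u s : posu u ->
  \sum_a udev u s a * logdev u s a =
  \sum_a (kldiv (u s a) (utilde u s * policy us s a) +
          kldiv (us s a) (utilde us s * policy u s a)).
Proof.
move=> u_gt0; apply/eqP; rewrite -subr_eq0 -sumrB.
rewrite (eq_bigr (fun a => (u s a - utilde u s * policy us s a) +
  (us s a - utilde us s * policy u s a))) => [|a _]; last first.
  by rewrite /kldiv !ln_div_utilde_policy// /udev /logdev; ring.
by rewrite big_split/= !sumrB !sum_utilde_policy// !subrr addr0.
Qed.

Lemma sum_udev_logdev_ge0 u s : posu u ->
  0 <= \sum_a udev u s a * logdev u s a.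
Proof.
move=> u_gt0; rewrite sum_udev_logdevE//; apply: sumr_ge0 => a _.
by rewrite addr_ge0// kldiv_ge0// mulr_gt0 ?policy_gt0// (utilde_gt0 _ a).
Qed.

(* [ln x <= x - 1] at [x = utilde u s / utilde us s]. *)
Lemma sum_us_logdev_ge u s : posu u ->
  - (\sum_a us s a * logdev u s a) <= \sum_a kldiv (us s a) (u s a).
Proof.
move=> u_gt0.
have -> : \sum_a kldiv (us s a) (u s a) =
    \sum_a (us s a * ln (us s a / u s a) - us s a + utilde u s * policy us s a).
  by rewrite big_split [in RHS]big_split/= sum_utilde_policy.
rewrite -sumrN; apply: ler_sum => a _.
have ut_gt0 := utilde_gt0 s a u_gt0; have ust_gt0 := utilde_gt0 s a us_gt0.
have : us s a * ln (utilde u s / utilde us s) <=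
    us s a * (utilde u s / utilde us s - 1).
  by rewrite ler_pM2l// ln_le_subr1// divr_gt0.
rewrite mulrBr mulr1 mulrCA -/(policy us s a) /logdev.
by rewrite !ln_div ?posrE//; lra.
Qed.

Lemma sum_udev_logdev_ge u m : posu u ->
  (forall s a, m <= u s a) -> (forall s a, m <= us s a) ->
  m / 4 * sumsq2 (logdev u) <= \sum_s \sum_a udev u s a * logdev u s a.
Proof.
move=> u_gt0 mu mus; rewrite mulr_sumr2; apply: ler_sum => s _.
rewrite sum_udev_logdevE//; apply: ler_sum => a _.
have ut_gt0 := utilde_gt0 s a u_gt0; have ust_gt0 := utilde_gt0 s a us_gt0.
rewrite -[logdev u s a]ln_div_utilde_policy//.
apply: kldivD_ge_sqr_ln; rewrite ?mulr_gt0 ?invr_gt0//.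
by rewrite !ln_div_utilde_policy// opprB.
Qed.

(* [u s a - us s a = (u s a - utilde u s * policy us s a) +
   (utilde u s - utilde us s) * policy us s a], where the first summand only
   sees the change of policy; since [gamma < 1], [Kadj] controls the second. *)
Lemma sum_norm_udev_le u U : posu u -> (forall s, utilde u s <= U) ->
  (1 - gamma) * \sum_s \sum_a `|udev u s a| <=
  \sum_s `|Kadj (udev u) s| + U * \sum_s \sum_a `|logdev u s a|.
Proof.
move=> u_gt0 utU.
suff : \sum_s \sum_a `|udev u s a| <=
    U * (\sum_s \sum_a `|logdev u s a|) + \sum_s `|utilde (udev u) s|.
  by have := sum_norm_utilde_le (udev u); lra.
rewrite mulr_sumr2 -big_split; apply: ler_sum => s _ /=.
apply: (@le_trans _ _ (\sum_a (U * `|logdev u s a| +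
    policy us s a * `|utilde (udev u) s|))); last first.
  by rewrite big_split/= lerD2l -mulr_suml ler_piMl ?sum_policy_le1.
apply: ler_sum => a _.
have ut_gt0 := utilde_gt0 s a u_gt0.
have pi_gt0 := policy_gt0 s a us_gt0.
have -> : udev u s a = (u s a - utilde u s * policy us s a) +
    policy us s a * utilde (udev u) s.
  rewrite [utilde (udev u) s]sumrB -!/(utilde _ _) /udev /policy.
  by field; rewrite gt_eqF// (utilde_gt0 _ a).
apply: le_trans (ler_normD _ _) _; rewrite normrM (gtr0_norm pi_gt0) lerD2r.
rewrite [logdev u s a](_ : _ = ln (u s a) - ln (utilde u s * policy us s a)).
  apply: dist_le_mul_dist_ln; rewrite ?(mulr_gt0 ut_gt0 pi_gt0)//.
    exact: le_trans (le_utilde s a u_gt0) (utU s).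
  by apply: le_trans (utU s); rewrite ler_piMr ?policy_le1 ?ltW.
by rewrite -[LHS]ln_div_utilde_policy// ln_div ?posrE ?(mulr_gt0 ut_gt0 pi_gt0).
Qed.

Lemma relent_ge0 u : posu u -> 0 <= relent u.
Proof. by move=> u_gt0; apply: sumr2_ge0 => s a; exact: kldiv_ge0. Qed.

Lemma sumsq_vdev_le_lyap v u : posu u -> alpha * sumsq (vdev v) <= 2 * lyap v u.
Proof.
by move=> /relent_ge0 /(mulr_ge0 (ltW tau_gt0)); rewrite /lyap; lra.
Qed.

Lemma relent_le_lyap v u : tau * relent u <= lyap v u.
Proof. by rewrite lerDr mulr_ge0 ?sumsq_ge0// divr_ge0 ?(ltW alpha_gt0). Qed.

Lemma lyap_ge0 v u : posu u -> 0 <= lyap v u.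
Proof.
move=> u_gt0; apply: le_trans (relent_le_lyap v u).
by rewrite mulr_ge0 ?relent_ge0// ltW.
Qed.

Lemma kldiv_le_lyap v u s a : posu u ->
  kldiv (us s a) (u s a) <= lyap v u / tau.
Proof.
move=> u_gt0; rewrite ler_pdivlMr// mulrC.
apply: le_trans (relent_le_lyap v u); rewrite ler_pM2l//.
apply: (ler_sum2_term (f := fun s a => kldiv (us s a) (u s a))) => t b.
exact: kldiv_ge0.
Qed.

Lemma dissip_ge0 v u : posu u -> 0 <= dissip v u.
Proof.
move=> u_gt0; have tau_ge0 := ltW tau_gt0; have alpha_ge0 := ltW alpha_gt0.
rewrite addr_ge0// mulr_ge0 ?sumsq_ge0//.
by apply: sumr_ge0 => s _; exact: sum_udev_logdev_ge0.
Qed.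

Lemma sum_udev_logdev_le : exists2 C, 0 < C & forall u, posu u ->
  \sum_s \sum_a udev u s a * logdev u s a <= C * (1 + relent u).
Proof.
have [B B_gt0 lnpiB] :=
  fin_ubound_gt0 (fun p : S * A => - ln (policy us p.1 p.2)).
pose N := \sum_s \sum_a us s a.
have N_ge0 : 0 <= N by apply: sumr2_ge0 => s a; exact: ltW.
exists (2 * B + 1 + 2 * B * N) => [|u u_gt0].
  by rewrite ltr_wpDr ?addr_gt0 ?mulr_ge0 ?mulr_gt0 ?(ltW B_gt0).
have u_logdev_le s a :
    u s a * logdev u s a <= 2 * B * (kldiv (us s a) (u s a) + us s a).
  apply: (@le_trans _ _ (u s a * B)).
    rewrite ler_pM2l// /logdev; have /= := lnpiB (s, a).
    by have := ln_le0 (policy_le1 s a u_gt0); lra.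
  have := le_kldivD (us_gt0 s a) (u_gt0 s a).
  by move/(ler_wpM2r (ltW B_gt0)); lra.
have -> : \sum_s \sum_a udev u s a * logdev u s a =
    \sum_s \sum_a u s a * logdev u s a -
    \sum_s \sum_a us s a * logdev u s a.
  rewrite -sumrB; apply: eq_bigr => s _.
  by rewrite -sumrB; apply: eq_bigr => a _; rewrite -mulrBl.
have us_part_le : - (\sum_s \sum_a us s a * logdev u s a) <= relent u.
  by rewrite -sumrN; apply: ler_sum => s _; exact: sum_us_logdev_ge.
have := ler_sum2 u_logdev_le; rewrite -mulr_sumr2.
have -> : \sum_s \sum_a (kldiv (us s a) (u s a) + us s a) = relent u + N.
  by rewrite -big_split; apply: eq_bigr => s _; rewrite big_split.
have relent_u_ge0 := relent_ge0 u_gt0.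
have := mulr_ge0 (ltW B_gt0) N_ge0; have := mulr_ge0 (ltW B_gt0) relent_u_ge0.
by have := mulr_ge0 (mulr_ge0 (ltW B_gt0) N_ge0) relent_u_ge0; lra.
Qed.

Lemma dissip_le_lyap : exists2 C, 0 < C &
  forall v u, posu u -> dissip v u <= C * (1 + lyap v u).
Proof.
have [B B_gt0 sumB] := sum_udev_logdev_le.
exists (2 + B * tau + B) => [|v u u_gt0]; first by rewrite !addr_gt0 ?mulr_gt0.
have := ler_wpM2l (ltW tau_gt0) (sumB u u_gt0).
have := ler_wpM2l (ltW B_gt0) (relent_le_lyap v u).
have := mulr_ge0 (ltW (mulr_gt0 B_gt0 tau_gt0)) (lyap_ge0 v u_gt0).
have := sumsq_vdev_le_lyap v u_gt0.
rewrite /dissip; move: (lyap v u) (\sum_s \sum_a _) => L J; lra.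
Qed.

Definition in_box m U u :=
  (forall s a, m <= u s a) /\ (forall s, utilde u s <= U).

Lemma sublevel_in_box M : exists m U, [/\ 0 < m, 0 < U, in_box m U us &
  forall v u, posu u -> lyap v u <= M -> in_box m U u].
Proof.
have [m1 m1_gt0 m1P] := fin_lbound_gt0
  (fun p : S * A => mulr_gt0 (us_gt0 p.1 p.2)
     (expR_gt0 (- (M / tau / us p.1 p.2 + 1)))).
have [m2 m2_gt0 m2P] := fin_lbound_gt0 (fun p : S * A => us_gt0 p.1 p.2).
have [U1 U1_gt0 U1P] := fin_ubound_gt0 (utilde us).
have [U2 U2_gt0 U2P] :=
  fin_ubound_gt0 (fun s => \sum_(a : A) 2 * (M / tau + us s a)).
exists (Num.min m1 m2), (U1 + U2); split=> [|||v u u_gt0 lyapM].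
- by rewrite lt_min m1_gt0.
- exact: addr_gt0.
- by split=> [s a|s]; [rewrite ge_min (m2P (s, a)) orbT | have := U1P s; lra].
have klM s a : kldiv (us s a) (u s a) <= M / tau.
  by apply: le_trans (kldiv_le_lyap v s a u_gt0) _; rewrite ler_pM2r ?invr_gt0.
split=> [s a|s].
  rewrite ge_min; apply/orP; left; apply: le_trans (m1P (s, a)) _.
  exact: kldiv_le_lbound.
apply: (@le_trans _ _ U2); last by rewrite lerDr ltW.
apply: le_trans (U2P s); apply: ler_sum => a _.
apply: le_trans (le_kldivD (us_gt0 s a) (u_gt0 s a)) _.
by rewrite ler_pM2l// lerD2r.
Qed.

Section BoxEstimates.
Variables m U : R.
Hypotheses (m_gt0 : 0 < m) (U_gt0 : 0 < U) (us_box : in_box m U us).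

Lemma in_box_gt0 u : in_box m U u -> posu u.
Proof. by move=> [mu _] s a; exact: lt_le_trans (mu s a). Qed.

Lemma in_box_le u s a : in_box m U u -> u s a <= U.
Proof.
by move=> u_box; apply: le_trans (le_utilde s a (in_box_gt0 u_box)) (u_box.2 s).
Qed.

Lemma dissip_coercive : exists2 k, 0 < k & forall v u, in_box m U u ->
  k * (sumsq (vdev v) + sumsq2 (logdev u)) <= dissip v u.
Proof.
exists (Num.min alpha (tau * (m / 4))) => [|v u u_box].
  by rewrite lt_min alpha_gt0 mulr_gt0 ?divr_gt0.
rewrite mulrDr lerD//; first by rewrite ler_wpM2r ?sumsq_ge0// ge_min lexx.
apply: (@le_trans _ _ (tau * (m / 4) * sumsq2 (logdev u))).
  by rewrite ler_wpM2r ?sumsq2_ge0// ge_min lexx orbT.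
rewrite -mulrA ler_pM2l//.
by apply: sum_udev_logdev_ge (in_box_gt0 u_box) u_box.1 us_box.1.
Qed.

Lemma sumsq_dev_le_lyap : exists2 C, 0 < C & forall v u, in_box m U u ->
  sumsq (vdev v) + sumsq2 (udev u) <= C * lyap v u.
Proof.
exists (2 / alpha + 4 * U / tau) => [|v u u_box].
  by rewrite addr_gt0 ?divr_gt0 ?mulr_gt0.
have u_gt0 := in_box_gt0 u_box; rewrite mulrDl lerD//.
  by rewrite mulrAC ler_pdivlMr// mulrC sumsq_vdev_le_lyap.
rewrite mulrAC ler_pdivlMr// mulrC.
apply: (@le_trans _ _ (4 * U * (tau * relent u))).
  rewrite mulrCA ler_pM2l// mulr_sumr2; apply: ler_sum2 => s a.
  apply: le_trans (sqr_dist_le_kldiv (us_gt0 s a) (u_gt0 s a)) _.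
  rewrite ler_wpM2r ?kldiv_ge0//.
  by have := in_box_le s a u_box; have := in_box_le s a us_box; lra.
by rewrite ler_wpM2l ?relent_le_lyap// mulr_ge0// ltW.
Qed.

Lemma sqr_norm1_dev_le_lyap : exists2 C, 0 < C & forall v u, in_box m U u ->
  (\sum_s `|vdev v s| + \sum_s \sum_a `|udev u s a|) ^+ 2 <= C * lyap v u.
Proof.
have [C C_gt0 devC] := sumsq_dev_le_lyap.
pose N : R := #|S|%:R + (#|S| * #|A|)%:R + 1.
have nS_ge0 : 0 <= #|S|%:R :> R by [].
have nSA_ge0 : 0 <= (#|S| * #|A|)%:R :> R by [].
have N_gt0 : 0 < N by rewrite ltr_wpDl// addr_ge0.
exists (2 * N * C) => [|v u u_box]; first by rewrite !mulr_gt0.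
have := sqr_sum_norm_le (vdev v); have := sqr_sum2_norm_le (udev u).
have := ler_wpM2l (ltW N_gt0) (devC v u u_box).
have := mulr_ge0 nSA_ge0 (sumsq_ge0 (vdev v)).
have := mulr_ge0 nS_ge0 (sumsq2_ge0 (udev u)).
have := sumsq_ge0 (vdev v); have := sumsq2_ge0 (udev u).
set x := \sum_s `|vdev v s|; set y := \sum_s \sum_a `|udev u s a|.
have := sqr_ge0 (x - y); rewrite /N; lra.
Qed.

Lemma norm_cross_le_lyap : exists2 C, 0 < C & forall v u, in_box m U u ->
  `|cross v u| <= C * lyap v u.
Proof.
have [C C_gt0 devC] := sumsq_dev_le_lyap.
pose N : R := (#|S| * (#|S| * #|A|))%:R; have N_ge0 : 0 <= N by [].
exists ((1 + N) * C) => [|v u u_box]; first by rewrite mulr_gt0// ltr_wpDr.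
rewrite /cross normrN; apply: le_trans (norm_sum_mul_le _ _ ltr01) _.
have := ler_wpM2l (addr_ge0 ler01 N_ge0) (devC v u u_box).
have := sumsq_Kadj_le (udev u); rewrite -/N mulrA.
have := mulr_ge0 N_ge0 (sumsq_ge0 (vdev v)).
have := mulr_ge0 N_ge0 (sumsq2_ge0 (udev u)).
have := sumsq_ge0 (vdev v); have := sumsq2_ge0 (udev u).
lra.
Qed.

Lemma sum_Kapp_logdev_le : exists2 C, 0 < C & forall w u, in_box m U u ->
  \sum_s \sum_a Kapp w s a * (u s a * (logdev u s a + Kapp w s a / tau)) <=
  C * (sumsq w + sumsq2 (logdev u)).
Proof.
pose N : R := (#|S| * #|A|)%:R * #|S|%:R.
have N_ge0 : 0 <= N by rewrite mulr_ge0.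
have itau_gt0 : 0 < tau^-1 by rewrite invr_gt0.
have c_gt0 : 0 < 1 + tau^-1 by rewrite addr_gt0.
have cN_ge0 : 0 <= (1 + tau^-1) * N by rewrite mulr_ge0// ltW.
exists (U * ((1 + tau^-1) * N + 1)) => [|w u u_box].
  by rewrite mulr_gt0// ltr_wpDl.
have u_gt0 := in_box_gt0 u_box.
have entry_le s a : Kapp w s a * (u s a * (logdev u s a + Kapp w s a / tau)) <=
    U * ((1 + tau^-1) * (#|S|%:R * sumsq w) + logdev u s a ^+ 2).
  have := Kapp_sqr_le w s a; move: (Kapp w s a) (logdev u s a) => x y x_le.
  rewrite mulrCA.
  apply: (@le_trans _ _ (u s a * ((1 + tau^-1) * x ^+ 2 + y ^+ 2))).
    rewrite ler_pM2l//; have := sqr_ge0 (x - y); have := sqr_ge0 (x + y); lra.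
  have sum_ge0 : 0 <= (1 + tau^-1) * x ^+ 2 + y ^+ 2.
    by rewrite addr_ge0 ?sqr_ge0// mulr_ge0 ?sqr_ge0// ltW.
  apply: (@le_trans _ _ (U * ((1 + tau^-1) * x ^+ 2 + y ^+ 2))).
    by rewrite ler_wpM2r// in_box_le.
  by rewrite ler_pM2l// lerD2r ler_pM2l.
apply: le_trans (ler_sum2 entry_le) _; rewrite -mulr_sumr2 -mulrA ler_pM2l//.
have -> : \sum_s \sum_a
    ((1 + tau^-1) * (#|S|%:R * sumsq w) + logdev u s a ^+ 2) =
    (1 + tau^-1) * N * sumsq w + sumsq2 (logdev u).
  transitivity (\sum_(s : S) \sum_(a : A) (1 + tau^-1) * (#|S|%:R * sumsq w) +
    sumsq2 (logdev u)).
    by rewrite -big_split; apply: eq_bigr => s _; rewrite big_split.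
  by rewrite sumr2_const /N; ring.
by have := mulr_ge0 cN_ge0 (sumsq2_ge0 (logdev u)); have := sumsq_ge0 w; lra.
Qed.

Lemma cross_rate_le : exists2 C, 0 < C & forall v u, in_box m U u ->
  cross_rate v u <= C * (sumsq (vdev v) + sumsq2 (logdev u)) -
    (2 * alpha)^-1 * sumsq (Kadj (udev u)).
Proof.
have [C C_gt0 KappC] := sum_Kapp_logdev_le.
exists (alpha / 2 + C) => [|v u u_box]; first by rewrite addr_gt0 ?divr_gt0.
have := KappC (vdev v) u u_box.
have := norm_sum_mul_le (vdev v) (Kadj (udev u)) alpha_gt0.
move/(le_trans (ler_norm _)); rewrite /cross_rate.
have -> : sumsq (Kadj (udev u)) / alpha =
    2 * (sumsq (Kadj (udev u)) / (2 * alpha)) by field; rewrite gt_eqF.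
rewrite [_^-1 * _]mulrC.
have := mulr_ge0 (ltW alpha_gt0) (sumsq2_ge0 (logdev u)).
lra.
Qed.

Lemma sumsq2_udev_le : exists2 C, 0 < C & forall u, in_box m U u ->
  sumsq2 (udev u) <= C * (sumsq2 (logdev u) + sumsq (Kadj (udev u))).
Proof.
pose N : R := 1 + #|S|%:R + U ^+ 2 * (#|S| * #|A|)%:R.
have gap_gt0 : 0 < (1 - gamma) ^+ 2 by rewrite exprn_gt0// subr_gt0.
have nS_ge0 : 0 <= #|S|%:R :> R by [].
have nSA_ge0 : 0 <= U ^+ 2 * (#|S| * #|A|)%:R by rewrite mulr_ge0 ?sqr_ge0.
have N_gt0 : 0 < N by rewrite !ltr_wpDr.
exists (2 * N / (1 - gamma) ^+ 2) => [|u u_box].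
  by rewrite divr_gt0// mulr_gt0.
rewrite mulrAC ler_pdivlMr// mulrC.
have norm_d_le := sum_norm_udev_le (in_box_gt0 u_box) u_box.2.
have norm_q_le := sqr_sum_norm_le (Kadj (udev u)).
have norm_y_le := sqr_sum2_norm_le (logdev u).
have sumsq2_d_le := sumsq2_le_sqr_sum_norm (udev u).
have norm_d_ge0 : 0 <= (1 - gamma) * \sum_s \sum_a `|udev u s a|.
  by rewrite mulr_ge0 ?sumr2_ge0// subr_ge0 ltW.
move: norm_d_le norm_q_le norm_y_le sumsq2_d_le norm_d_ge0.
set norm_d := \sum_s \sum_a `|udev u s a|.
set norm_y := \sum_s \sum_a `|logdev u s a|; set norm_q := \sum_s `|Kadj _ s|.
move=> norm_d_le norm_q_le norm_y_le sumsq2_d_le norm_d_ge0.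
apply: (@le_trans _ _ ((norm_q + U * norm_y) ^+ 2)).
  apply: (@le_trans _ _ (((1 - gamma) * norm_d) ^+ 2)).
    by rewrite exprMn ler_pM2l.
  by rewrite ler_sqr ?nnegrE// (le_trans norm_d_ge0).
have := ler_wpM2l (sqr_ge0 U) norm_y_le.
have := sqr_ge0 (norm_q - U * norm_y).
have := mulr_ge0 nS_ge0 (sumsq2_ge0 (logdev u)).
have := mulr_ge0 nSA_ge0 (sumsq_ge0 (Kadj (udev u))).
have := sumsq_ge0 (Kadj (udev u)); have := sumsq2_ge0 (logdev u).
by rewrite /N; lra.
Qed.

Lemma lyap_le : exists2 C, 0 < C & forall v u, in_box m U u ->
  lyap v u <= C * (sumsq (vdev v) + sumsq2 (logdev u) + sumsq (Kadj (udev u))).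
Proof.
have [C C_gt0 udevC] := sumsq2_udev_le.
exists (alpha / 2 + tau / m * C) => [|v u u_box].
  by rewrite addr_gt0 ?divr_gt0// mulr_gt0 ?divr_gt0.
have relent_le : relent u <= sumsq2 (udev u) / m.
  rewrite mulrC mulr_sumr2; apply: ler_sum2 => s a.
  have u_gt0 := in_box_gt0 u_box s a.
  apply: le_trans (kldiv_le_chi2 (us_gt0 s a) u_gt0) _.
  rewrite mulrC ler_wpM2r ?sqr_ge0// lef_pV2 ?posrE//; exact: u_box.1.
have taum_gt0 : 0 < tau / m by rewrite divr_gt0.
have := ler_wpM2l (ltW tau_gt0) relent_le.
have := ler_wpM2l (ltW taum_gt0) (udevC u u_box).
have := mulr_ge0 (ltW (mulr_gt0 taum_gt0 C_gt0)) (sumsq_ge0 (vdev v)).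
have := mulr_ge0 (ltW alpha_gt0) (sumsq2_ge0 (logdev u)).
have := mulr_ge0 (ltW alpha_gt0) (sumsq_ge0 (Kadj (udev u))).
rewrite /lyap; lra.
Qed.

Lemma box_hypocoercivity : exists eps c, [/\ 0 < eps, 0 < c &
  forall v u, in_box m U u -> `|eps * cross v u| <= lyap v u / 2 /\
    c * lyap v u <= dissip v u - eps * cross_rate v u].
Proof.
have [k k_gt0 dissip_ge] := dissip_coercive.
have [B B_gt0 cross_le] := norm_cross_le_lyap.
have [C C_gt0 rate_le] := cross_rate_le.
have [E E_gt0 lyapE] := lyap_le.
have ialpha_gt0 : 0 < (2 * alpha)^-1 by rewrite invr_gt0 mulr_gt0.
have [eps [c [eps_gt0 c_gt0 combine]]] :=
  hypocoercivity_constants k_gt0 ialpha_gt0 B_gt0 C_gt0 E_gt0.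
exists eps, c; split=> // v u u_box.
apply: combine (dissip_ge v u u_box) (cross_le v u u_box)
  (rate_le v u u_box) (lyapE v u u_box); last exact: sumsq_ge0.
by rewrite addr_ge0 ?sumsq_ge0 ?sumsq2_ge0.
Qed.

End BoxEstimates.

Section FirstOrderConditions.
Hypothesis saddle : is_saddle alpha tau gamma P r vs us.

Lemma Efun_quadraticE v u : Efun alpha tau gamma P r v u =
  \sum_s (alpha / 2 * v s ^+ 2 - v s * Kadj u s) +
  \sum_s \sum_a u s a * (r s a - tau * ln (policy u s a)).
Proof.
rewrite /Efun sumrB -sum_mul_Kapp -mulr_sumr mulr_sumr2 -!addrA; congr (_ + _).
rewrite [RHS]addrC -!sumrB; apply: eq_bigr => s _.
by rewrite -!sumrB; apply: eq_bigr => a _; rewrite /Kapp /policy; ring.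
Qed.

Lemma Efun_entropyE v u : Efun alpha tau gamma P r v u =
  alpha / 2 * sumsq v +
  \sum_s \sum_a u s a * (r s a - Kapp v s a - tau * ln (policy u s a)).
Proof.
rewrite /Efun -addrA; congr (_ + _); rewrite mulr_sumr2 -sumrB.
apply: eq_bigr => s _; rewrite -sumrB; apply: eq_bigr => a _.
by rewrite /Kapp /policy; ring.
Qed.

Lemma is_derive_ln_policy (u : R -> S -> A -> R) du (t : R) s a : posu (u t) ->
  (forall b, is_derive t (1 : R) (fun x : R => u x s b) (du s b)) ->
  is_derive t (1 : R) (fun x : R => ln (policy (u x) s a))
    (du s a / u t s a - utilde du s / utilde (u t) s).
Proof.
move=> ut_gt0 uP.
exact: is_derive_ln_div (ut_gt0 s a) (utilde_gt0 s a ut_gt0) (uP a)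
  (is_derive_fsum uP).
Qed.

(* The derivative of [ln (policy u)] does not contribute, because
   [\sum_a policy u s a] is constant. *)
Lemma is_derive_Efun v (u : R -> S -> A -> R) du (t : R) : posu (u t) ->
  (forall s a, is_derive t (1 : R) (fun x : R => u x s a) (du s a)) ->
  is_derive t (1 : R) (fun x : R => Efun alpha tau gamma P r v (u x))
    (\sum_s \sum_a du s a * (r s a - Kapp v s a - tau * ln (policy (u t) s a))).
Proof.
move=> ut_gt0 uP; under [fun x => _]eq_fun do rewrite Efun_entropyE.
pose weight u s a := r s a - Kapp v s a - tau * ln (policy u s a).
have weightP s a : is_derive t (1 : R) (fun x : R => weight (u x) s a)
    (0 - tau * (du s a / u t s a - utilde du s / utilde (u t) s)).
  have logP := is_derive_ln_policy a ut_gt0 (uP s).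
  exact: is_deriveB (is_derive_cst _ t 1) (is_derive_scalef tau logP).
have sumP := is_derive_fsum (fun s => is_derive_fsum (fun a =>
  is_derive_mulf (uP s a) (weightP s a))).
have constP := is_derive_cst (alpha / 2 * sumsq v) t (1 : R).
apply: is_derive_eq (is_deriveD constP sumP) _.
rewrite add0r; apply: eq_bigr => s _.
transitivity (\sum_a (du s a * weight (u t) s a -
    tau * (du s a - utilde du s * policy (u t) s a))); last first.
  by rewrite sumrB -mulr_sumr sumrB sum_utilde_policy// subrr mulr0 subr0.
apply: eq_bigr => a _; rewrite /policy.
by field; rewrite !gt_eqF// (utilde_gt0 _ a).
Qed.

Lemma saddle_value s : alpha * vs s = Kadj us s.
Proof.
have [_ [vs_min _]] := saddle.
have := vs_min (fun s => Kadj us s / alpha).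
rewrite !Efun_quadraticE lerD2r -subr_ge0 -sumrB.
rewrite (eq_bigr (fun s => - ((alpha * vs s - Kadj us s) ^+ 2 / (2 * alpha)))).
  rewrite sumrN oppr_ge0 => gap_le0.
  have gap_ge0 t : 0 <= (alpha * vs t - Kadj us t) ^+ 2 / (2 * alpha).
    by rewrite divr_ge0 ?sqr_ge0// mulr_ge0// ltW.
  have := le_trans (ler_sum_term s gap_ge0) gap_le0.
  rewrite pmulr_lle0 ?invr_gt0 ?mulr_gt0// => sqr_le0.
  by apply/eqP; rewrite -subr_eq0 -sqrf_eq0 eq_le sqr_le0 sqr_ge0.
by move=> t _; field; rewrite gt_eqF.
Qed.

(* [Efun vs] is stationary at [us] along [x |-> us * exp (x * g)], where [g] is
   its gradient. *)
Lemma saddle_policy s a : tau * ln (policy us s a) = r s a - Kapp vs s a.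
Proof.
have [_ [_ us_max]] := saddle.
pose g s a := r s a - Kapp vs s a - tau * ln (policy us s a).
pose u (x : R) s a := us s a * expR (g s a * x).
have u_gt0 x : posu (u x) by move=> t b; rewrite mulr_gt0 ?expR_gt0.
have u0 : u 0 = us.
  by apply/funext => t; apply/funext => b; rewrite /u mulr0 expR0 mulr1.
have EP x := is_derive_Efun vs (u_gt0 x)
  (fun t b => is_derive_scalef (us t b) (is_derive_expRM (g t b) x)).
have E_max : is_derive (0 : R) (1 : R)
    (fun x => Efun alpha tau gamma P r vs (u x)) 0.
  apply: (@derive1_at_max _ _ (-1) 1) => [|x _||x _].
  - lra.
  - by have [] := EP x.
  - by rewrite in_itv/=; apply/andP; split; lra.
  - by rewrite u0; exact: us_max.
have [_ dE0] := E_max; have [_] := EP 0; rewrite dE0 u0 => sum_eq0.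
have term_ge0 t b : 0 <= us t b * g t b ^+ 2.
  by rewrite mulr_ge0 ?sqr_ge0// ltW.
have := ler_sum2_term s a term_ge0.
rewrite (_ : \sum_t \sum_b _ = 0); last first.
  rewrite [RHS]sum_eq0; apply: eq_bigr => t _; apply: eq_bigr => b _.
  by rewrite mulr0 expR0 mulr1 -mulrA -expr2.
rewrite pmulr_rle0// => sqr_le0; apply/esym/eqP.
by rewrite -subr_eq0 -sqrf_eq0 eq_le sqr_le0 sqr_ge0.
Qed.

End FirstOrderConditions.

Section Dynamics.
Hypotheses (vs_stationary : forall s, alpha * vs s = Kadj us s)
  (us_stationary : forall s a,
     tau * ln (policy us s a) = r s a - Kapp vs s a).

Definition trajectory (v : R -> S -> R) (u : R -> S -> A -> R) : Prop :=
  [/\ forall t : R, 0 < t -> posu (u t),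
      forall t : R, 0 < t -> forall s, is_derive t (1 : R)
        (fun x : R => v x s) (vfield alpha gamma P (v t) (u t) s) &
      forall t : R, 0 < t -> forall s a, is_derive t (1 : R)
        (fun x : R => u x s a) (ufield tau gamma P r (v t) (u t) s a)].

Lemma vfieldE v u s :
  vfield alpha gamma P v u s = - (vdev v s - Kadj (udev u) s / alpha).
Proof.
rewrite /vfield /vdev KadjB -vs_stationary -/(Kadj u s).
by field; rewrite gt_eqF.
Qed.

Lemma ufieldE v u s a : ufield tau gamma P r v u s a =
  - (u s a * (logdev u s a + Kapp (vdev v) s a / tau)).
Proof.
rewrite /ufield /logdev KappB -/(Kapp v s a) -/(policy u s a).
have -> : ln (policy us s a) = (r s a - Kapp vs s a) / tau.
  by rewrite -us_stationary; field; rewrite gt_eqF.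
by field; rewrite gt_eqF.
Qed.

Section Trajectory.
Variables (v : R -> S -> R) (u : R -> S -> A -> R).
Hypothesis traj : trajectory v u.
Implicit Types t x : R.

Let u_gt0 t : 0 < t -> posu (u t). Proof. by case: traj => + _ _; apply. Qed.

Lemma is_derive_vdev t s : 0 < t -> is_derive t (1 : R)
  (fun x => vdev (v x) s) (- (vdev (v t) s - Kadj (udev (u t)) s / alpha)).
Proof.
move=> t_gt0; case: traj => _ vP _; rewrite -vfieldE.
exact: is_derive_subc (vP t t_gt0 s).
Qed.

Lemma is_derive_udev t s a : 0 < t -> is_derive t (1 : R)
  (fun x => udev (u x) s a)
  (- (u t s a * (logdev (u t) s a + Kapp (vdev (v t)) s a / tau))).
Proof.
move=> t_gt0; case: traj => _ _ uP; rewrite -ufieldE.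
exact: is_derive_subc (uP t t_gt0 s a).
Qed.

Lemma is_derive_sumsq_vdev t : 0 < t -> is_derive t (1 : R)
  (fun x => sumsq (vdev (v x)))
  (- (2 * sumsq (vdev (v t))) +
   2 / alpha * \sum_s vdev (v t) s * Kadj (udev (u t)) s).
Proof.
move=> t_gt0.
have sqrP s := is_derive_mulf (is_derive_vdev s t_gt0) (is_derive_vdev s t_gt0).
apply: is_derive_eq (is_derive_fsum sqrP) _.
rewrite /sumsq !mulr_sumr -sumrN -big_split; apply: eq_bigr => s _ /=.
by field; rewrite gt_eqF.
Qed.

Lemma is_derive_relent t : 0 < t -> is_derive t (1 : R)
  (fun x => relent (u x))
  (- (\sum_s \sum_a udev (u t) s a * logdev (u t) s a) -
   tau^-1 * \sum_s vdev (v t) s * Kadj (udev (u t)) s).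
Proof.
move=> t_gt0; case: (traj) => _ _ uP.
have klP s a := is_derive_kldiv (us_gt0 s a) (u_gt0 t_gt0 s a) (uP t t_gt0 s a).
apply: is_derive_eq (is_derive_fsum (fun s => is_derive_fsum (klP s))) _.
rewrite -sum_mul_Kapp mulr_sumr2 -sumrN -sumrB; apply: eq_bigr => s _.
rewrite -sumrN -sumrB; apply: eq_bigr => a _.
by rewrite ufieldE /udev; field; rewrite !gt_eqF ?(u_gt0 t_gt0 s a).
Qed.

Lemma is_derive_lyap t : 0 < t -> is_derive t (1 : R)
  (fun x => lyap (v x) (u x)) (- dissip (v t) (u t)).
Proof.
move=> t_gt0.
have vP := is_derive_scalef (alpha / 2) (is_derive_sumsq_vdev t_gt0).
have uP := is_derive_scalef tau (is_derive_relent t_gt0).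
apply: is_derive_eq (is_deriveD vP uP) _.
by rewrite /dissip; field; rewrite !gt_eqF.
Qed.

Lemma is_derive_cross t : 0 < t -> is_derive t (1 : R)
  (fun x => cross (v x) (u x)) (cross_rate (v t) (u t)).
Proof.
move=> t_gt0.
pose du s a := - (u t s a * (logdev (u t) s a + Kapp (vdev (v t)) s a / tau)).
have KadjP s' :
    is_derive t (1 : R) (fun x => Kadj (udev (u x)) s') (Kadj du s').
  apply: is_derive_fsum => s; apply: is_derive_fsum => a.
  exact: is_derive_scalef (is_derive_udev s a t_gt0).
have termP s := is_derive_mulf (is_derive_vdev s t_gt0) (KadjP s).
apply: is_derive_eq (is_deriveN (is_derive_fsum termP)) _.
rewrite big_split/= -sum_mul_Kapp opprD addrC; congr (_ + _).
  by rewrite /sumsq mulr_suml -sumrN -sumrB; apply: eq_bigr => s _; ring.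
rewrite -sumrN; apply: eq_bigr => s _; rewrite -sumrN; apply: eq_bigr => a _.
by rewrite /du; ring.
Qed.

Lemma lyap_nincr t1 t2 : 0 < t1 -> t1 <= t2 ->
  lyap (v t2) (u t2) <= lyap (v t1) (u t1).
Proof.
move=> t1_gt0 t12.
apply: (@is_derive_le0_nincr _ (fun t => lyap (v t) (u t))
  (fun t => - dissip (v t) (u t))) => // t t1t.
  by apply: is_derive_lyap; exact: lt_le_trans t1t.
by rewrite oppr_le0; apply/dissip_ge0/u_gt0; exact: lt_le_trans t1t.
Qed.

(* By [dissip_le_lyap], [lyap] cannot blow up as [t] decreases to [0]. *)
Lemma lyap_bounded :
  exists2 M, 0 < M & forall t, 0 < t -> lyap (v t) (u t) <= M.
Proof.
have [C C_gt0 dissipC] := dissip_le_lyap.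
pose g t := - (1 + lyap (v t) (u t)).
have gP t : 0 < t -> is_derive t (1 : R) g (dissip (v t) (u t)).
  move=> t_gt0; have lyapP := is_derive_lyap t_gt0.
  have oneP := is_derive_cst (1 : R) t (1 : R).
  apply: is_derive_eq (is_deriveN (is_deriveD oneP lyapP)) _.
  by rewrite add0r opprK.
have lyap1_gt0 : 0 < 1 + lyap (v 1) (u 1).
  by rewrite ltr_wpDr//; exact: lyap_ge0 (u_gt0 ltr01).
exists ((1 + lyap (v 1) (u 1)) * expR C) => [|t t_gt0].
  by rewrite mulr_gt0 ?expR_gt0.
have [t_ge1|/ltW t_le1] := leP 1 t.
  apply: le_trans (lyap_nincr ltr01 t_ge1) _.
  apply: (@le_trans _ _ (1 + lyap (v 1) (u 1))); first by rewrite lerDr.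
  by rewrite ler_peMr ?ltW ?expR_gt1.
have := @gronwall _ g (fun x => dissip (v x) (u x)) C t 1 t_le1.
rewrite /g mulNr lerN2 expRN ler_pdivrMr ?expR_gt0// => lyap_growth.
apply: (@le_trans _ _ (1 + lyap (v t) (u t))); first by rewrite lerDr.
apply: le_trans (lyap_growth _ _) _ => [x tx|x tx|].
- by apply: gP; exact: lt_le_trans tx.
- by rewrite mulrN opprK; apply/dissipC/u_gt0; exact: lt_le_trans tx.
rewrite ler_pM2l// ler_expR -[leRHS]mulr1.
by rewrite ler_wpM2l ?(ltW C_gt0)//; lra.
Qed.

End Trajectory.

Lemma lyap_sublevel_decay M : exists2 c, 0 < c &
  forall (v : R -> S -> R) (u : R -> S -> A -> R), trajectory v u ->
  forall t0 t : R, 0 < t0 -> t0 <= t -> lyap (v t0) (u t0) <= M ->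
  lyap (v t) (u t) <= 3 * lyap (v t0) (u t0) * expR (- (c * (t - t0))).
Proof.
have [m [U [m_gt0 U_gt0 us_box boxM]]] := sublevel_in_box M.
have [eps [c [eps_gt0 c_gt0 hypoc]]] := box_hypocoercivity m_gt0 U_gt0 us_box.
exists (c / 2) => [|v u traj t0 t t0_gt0 t0t lyapM]; first by rewrite divr_gt0.
have x_gt0 x : t0 <= x -> 0 < x by exact: lt_le_trans.
have box x : t0 <= x -> in_box m U (u x).
  move=> t0x; apply: (boxM (v x)).
    by case: traj => + _ _; apply; exact: x_gt0.
  by apply: le_trans lyapM; exact: lyap_nincr.
apply: (modified_energy_decay (L := fun x => lyap (v x) (u x))
  (X := fun x => cross (v x) (u x)) (dL := fun x => - dissip (v x) (u x))
  (dX := fun x => cross_rate (v x) (u x)) (eps := eps)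
  (ltW c_gt0) t0t) => x t0x.
- by apply: is_derive_lyap => //; exact: x_gt0.
- by apply: is_derive_cross => //; exact: x_gt0.
- by have [] := hypoc (v x) (u x) (box x t0x).
- by rewrite opprD opprK; have [] := hypoc (v x) (u x) (box x t0x).
Qed.

Lemma trajectory_enters_sublevel (v : R -> S -> R) (u : R -> S -> A -> R) eps :
  trajectory v u -> 0 < eps ->
  exists2 t : R, 0 < t & lyap (v t) (u t) <= eps.
Proof.
move=> traj eps_gt0; have [M M_gt0 lyapM] := lyap_bounded traj.
have [c c_gt0 decay] := lyap_sublevel_decay M.
pose delay := 3 * M / eps / c.
have delay_ge0 : 0 <= delay by rewrite !divr_ge0 ?mulr_ge0 ?ltW.
exists (1 + delay); first by rewrite ltr_wpDr.
have := decay v u traj 1 (1 + delay) ltr01 _ (lyapM 1 ltr01).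
rewrite lerDl addrAC subrr add0r => /(_ delay_ge0) /le_trans; apply.
rewrite expRN ler_pdivrMr ?expR_gt0//.
apply: (@le_trans _ _ (3 * M)); first by rewrite ler_pM2l ?lyapM.
have -> : c * delay = 3 * M / eps by rewrite /delay mulrC divfK ?gt_eqF.
rewrite -ler_pdivrMl// mulrC; have := expR_ge1Dx (3 * M / eps); lra.
Qed.

Lemma lyap_exp_decay : exists2 c, 0 < c &
  forall (v : R -> S -> R) (u : R -> S -> A -> R), trajectory v u ->
  exists2 C, 0 <= C &
  forall t : R, 0 < t -> lyap (v t) (u t) <= C * expR (- (c * t)).
Proof.
have [c c_gt0 decay] := lyap_sublevel_decay 1; exists c => // v u traj.
have [M M_gt0 lyapM] := lyap_bounded traj.
have [t1 t1_gt0 lyap_t1] := trajectory_enters_sublevel traj ltr01.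
exists ((M + 3) * expR (c * t1)) => [|t].
  by rewrite mulr_ge0 ?expR_ge0// addr_ge0// ltW.
apply: (eventually_expR_decay (f := fun t => lyap (v t) (u t)) _ (ltW M_gt0)) =>
  [|//|//|x t1x]; first exact: ltW.
apply: le_trans (decay v u traj t1 x t1_gt0 t1x lyap_t1) _.
by rewrite ler_wpM2r ?expR_ge0//; lra.
Qed.

Lemma trajectory_exp_decay : exists2 c, 0 < c &
  forall (v : R -> S -> R) (u : R -> S -> A -> R), trajectory v u ->
  exists C, forall t : R, 0 < t ->
    \sum_s `|vdev (v t) s| + \sum_s \sum_a `|udev (u t) s a|
      <= C * expR (- (c * t)).
Proof.
have [c c_gt0 decay] := lyap_exp_decay.
exists (c / 2) => [|v u traj]; first by rewrite divr_gt0.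
have [M M_ge0 lyapM] := decay v u traj.
have [m [U [m_gt0 U_gt0 us_box boxM]]] := sublevel_in_box M.
have [N N_gt0 normN] := sqr_norm1_dev_le_lyap m_gt0 U_gt0 us_box.
exists (Num.sqrt (N * M)) => t t_gt0.
apply: le_sqrt_expR_half; first by rewrite mulr_ge0// ltW.
apply: le_trans (normN (v t) (u t) _) _.
  apply: (boxM (v t)); first by case: traj => + _ _; apply.
  apply: le_trans (lyapM t t_gt0) _; rewrite ler_piMr// expR_le1.
  by rewrite oppr_le0 mulr_ge0 ?ltW.
by rewrite -mulrA ler_pM2l// lyapM.
Qed.

End Dynamics.

End RegularizedMDP.

Theorem theorem2p5 (R : realType) (S A : finType)
  (P : S -> A -> S -> R) (r : S -> A -> R) (gamma tau alpha : R)
  (HP0 : forall s a s', 0 <= P s a s')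
  (HP1 : forall s a, \sum_(s' : S) P s a s' = 1)
  (Hr : forall s a, 0 <= r s a)
  (Hg0 : 0 < gamma) (Hg1 : gamma < 1) (Htau : 0 < tau) (Halpha : 0 < alpha)
  (vs : S -> R) (us : S -> A -> R)
  (Hsaddle : is_saddle alpha tau gamma P r vs us) :
  exists c : R, 0 < c /\
  forall (v : R -> S -> R) (u : R -> S -> A -> R),
    (forall t : R, 0 < t -> forall s a, 0 < u t s a) ->
    (forall t : R, 0 < t -> forall s',
       is_derive t (1:R) (fun x : R => v x s') (vfield alpha gamma P (v t) (u t) s')) ->
    (forall t : R, 0 < t -> forall s a,
       is_derive t (1:R) (fun x : R => u x s a) (ufield tau gamma P r (v t) (u t) s a)) ->
    exists C : R, forall t : R, 0 < t ->
      \sum_(s : S) `|v t s - vs s| + \sum_(s : S) \sum_(a : A) `|u t s a - us s a|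
        <= C * expR (- (c * t)).
Proof.
have us_gt0 : posu us by case: Hsaddle.
have [c c_gt0 decay] := trajectory_exp_decay HP0 HP1 Hg0 Hg1 Htau Halpha us_gt0
  (saddle_value Halpha Hsaddle) (saddle_policy us_gt0 Hsaddle).
by exists c; split=> // v u u_gt0 vP uP; apply: decay; split.
Qed.
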